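(* Let $R(S,\kappa)$ be a near-integral fusion ring. The formal codegrees of $R(S,\kappa)$ are the set of formal codegrees $f$ of $S$ such that $f\neq\mathrm{FPdim}(S)$, along with $\mathrm{FPdim}(S)+d_+^2$ and $\mathrm{FPdim}(S)+d_-^2$.
   Context: A fusion ring $(R,B)$ is a unital associative ring $R$, free as a $\mathbb{Z}$-module with finite basis $B=\{1_R=b_1,\ldots,b_n\}$, such that $b_ib_j=\sum_k c_{ij}^kb_k$ with $c_{ij}^k\in\mathbb{Z}_{\geq0}$, together with an involution $\ast$ of $\{1,\ldots,n\}$ such that $\sum_ja_jb_j\mapsto\sum_ja_jb_{j^\ast}$ is an antiautomorphism of $R$ and $c_{ij}^1=1$ if $i=j^\ast$ and $0$ otherwise. $\mathrm{FPdim}:R\to\mathbb{C}$ is the ring homomorphism sending each $b_i\in B$ to the maximal real eigenvalue of $[c_{ij}^k]_{j,k}$, and $\mathrm{FPdim}(R):=\sum_{b\in B}\mathrm{FPdim}(b)^2$ (likewise for $S$). $\mathrm{Irr}(R)$ is the set of isomorphism classes of finite-dimensional complex irreducible representations of $R$. For $\varphi\in\mathrm{Irr}(R)$, the formal codegree $f_\varphi$ is the scalar by which the central element $\sum_{b\in B}\mathrm{Tr}(\varphi(b))\,b^\ast\in R\otimes_{\mathbb{Z}}\mathbb{C}$ acts in $\varphi$; the formal codegrees of $R$ are the numbers $f_\varphi$ for $\varphi\in\mathrm{Irr}(R)$. A fusion subring is a fusion ring $(S,C)$ with $C\subseteq B$ and $S\subseteq R$ the $\mathbb{Z}$-span of $C$.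 $(R,B)$ is near-integral if it has a fusion subring $(S,C)$ with $|C|+1=|B|$. Then $\rho$ denotes the unique element of $B\setminus C$, $\kappa:=c_{\rho,\rho}^\rho\in\mathbb{Z}_{\geq0}$, and $R$ is denoted $R(S,\kappa)$; its fusion rules are those of $S$ together with $x\rho=\rho x=\mathrm{FPdim}(x)\rho$ for $x\in C$ and $\rho^2=\kappa\rho+\sum_{x\in C}\mathrm{FPdim}(x)x$. $d_+=\mathrm{FPdim}(\rho)$ and $d_-$ are the positive and negative roots of $x^2-\kappa x-\mathrm{FPdim}(S)=0$.
   Formalization: Codegrees are counted with multiplicity, and ''f ≠ FPdim(S)'' is replaced by removing one occurrence of FPdim(S) (that of the character FPdim); removing every f equal to FPdim(S) fails for S = Z[Z/2], κ = 0, where 2 = FPdim(S) remains a formal codegree of R. *)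

(* Defs.v *)
(* MathComp with MathComp-Analysis (reals) and real-closed (complex).         *)
From HB Require Import structures.
From mathcomp Require Import all_boot all_order all_algebra.
From mathcomp Require Import classical_sets reals.
From mathcomp Require Export complex.

Set Implicit Arguments.
Unset Strict Implicit.
Unset Printing Implicit Defensive.

Import Order.TTheory GRing.Theory Num.Theory.
Local Open Scope ring_scope.
Local Open Scope complex_scope.

(* The basis is indexed by 'I_rk, and the basis element 1 = b_1 of the        *)
(* mathematical definition is basis idx1.  The coordinate functions witness   *)
(* that basis is a Z-basis (and are determined by it); they are used to write *)
(* the Z-linear extension of b_i |-> b_(i^* ).                                *)
Record fusionRing := FusionRing {
  fring :> nzRingType;
  rk : nat;
  basis : 'I_rk -> fring;
  coord : fring -> 'I_rk -> int;
  coord_basis : forall x : fring, x = \sum_i basis i *~ coord x i;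
  coord_sum : forall (a : 'I_rk -> int) (i : 'I_rk),
    coord (\sum_j basis j *~ a j) i = a i;
  idx1 : 'I_rk;
  basis1 : basis idx1 = 1;
  fcoef : 'I_rk -> 'I_rk -> 'I_rk -> nat;
  basisM : forall i j : 'I_rk,
    basis i * basis j = \sum_k basis k *+ fcoef i j k;
  dual : 'I_rk -> 'I_rk;
  dualK : involutive dual;
  dual_antimorph : forall x y : fring,
    let star z := \sum_i basis (dual i) *~ coord z i in
    star (x * y) = star y * star x;
  fcoef1 : forall i j : 'I_rk, fcoef i j idx1 = (i == dual j)
}.

Section FPdim.
Variables (K : realType) (F : fusionRing).

Definition fusion_mx (i : 'I_(rk F)) : 'M[K]_(rk F) :=
  \matrix_(j, k) (fcoef i j k)%:R.

(* FPdim (b_i).  The set of real eigenvalues is finite and, by the            *)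
(* Perron-Frobenius theorem, not empty, so its supremum is its maximum.       *)
Definition FPdim (i : 'I_(rk F)) : K :=
  sup [set a : K | eigenvalue (fusion_mx i) a]%classic.

Definition FPdim_ring : K := \sum_i FPdim i ^+ 2.

End FPdim.

Section Representations.
Variables (K : realType) (F : fusionRing).

(* x acts on column vectors by v |-> phi x *m v.  A subspace of K[i]^d is     *)
(* given by a matrix U whose rows are the transposes of spanning vectors, so  *)
(* its stability under phi x is the stability of U under (phi x)^T.           *)
Definition irreducible_repr (d : nat) (phi : F -> 'M[K[i]]_d.+1) : Prop :=
  forall U : 'M[K[i]]_d.+1,
    (forall x : F, stablemx U (phi x)^T) -> U = 0 \/ row_full U.

Record irrep := Irrep {
  irrep_deg : nat;
  irrep_repr : {rmorphism F -> 'M[K[i]]_irrep_deg.+1};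
  irrep_irr : irreducible_repr irrep_repr
}.

(* A matrix that is both row_free and row_full is square and invertible.      *)
Definition irrep_iso (phi psi : irrep) : Prop :=
  exists P : 'M[K[i]]_((irrep_deg psi).+1, (irrep_deg phi).+1),
    [/\ row_free P, row_full P &
        forall x : F, P *m irrep_repr phi x = irrep_repr psi x *m P].

Definition is_formal_codegree (phi : irrep) (f : K[i]) : Prop :=
  \sum_i \tr (irrep_repr phi (basis i)) *: irrep_repr phi (basis (dual i))
    = f%:M.

(* s lists the numbers f_phi, for phi ranging over Irr(F), with one entry per *)
(* isomorphism class: the formal codegrees are taken with multiplicity, and s *)
(* is determined up to permutation.  Distinct classes may share a codegree:   *)
(* all formal codegrees of the group ring of a finite abelian group G are     *)
(* equal to #|G|.                                                             *)
Definition formal_codegrees (s : seq K[i]) : Prop :=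
  exists phi : 'I_(size s) -> irrep,
    [/\ forall i j, irrep_iso (phi i) (phi j) -> i = j,
        forall psi : irrep, exists i, irrep_iso psi (phi i) &
        forall i, is_formal_codegree (phi i) s`_i].

End Representations.

(* A fusion subring (S, C) of (R, B), presented as the fusion ring S with the *)
(* inclusion of S in R and the induced inclusion of C in B.                   *)
Record fusionInclusion (S R : fusionRing) := FusionInclusion {
  incl_ring :> {rmorphism S -> R};
  incl_idx : 'I_(rk S) -> 'I_(rk R);
  incl_idx_inj : injective incl_idx;
  incl_basis : forall i, incl_ring (basis i) = basis (incl_idx i)
}.

(* Main.v *)
Require Import Defs.
From HB Require Import structures.
From mathcomp Require Import all_boot all_order all_algebra.
From mathcomp Require Import boolp classical_sets reals complex ring.

(* Comparing coefficients of 1 shows x rho = rho x = n(x) rho for a positive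
   integral character n of S, and rho^2 = kappa rho + lambda with
   lambda = sum_b n(b) b; positivity forces n = FPdim, without invoking the
   Perron-Frobenius theorem.  An irreducible representation of S kills lambda
   unless it is n, and those killing lambda are exactly the restrictions of the
   irreducible representations of R killing rho, with the same formal codegree.
   On the remaining representations of R, rho acts by a root t of
   t^2 = kappa t + FPdim(S) and x by n(x), and the formal codegree is
   FPdim(S) + t^2.  Orthogonality of characters bounds the number of classes. *)

Set Implicit Arguments.
Unset Strict Implicit.
Unset Printing Implicit Defensive.

Import Order.TTheory GRing.Theory Num.Theory.
Local Open Scope ring_scope.
Local Open Scope complex_scope.

Section FusionRing.
Variable F : fusionRing.
Implicit Types (x y z : F) (i j k : 'I_(rk F)).

Definition coef k x : int := Defs.coord x k.

Lemma basis_expansion x : x = \sum_k basis k *~ coef k x.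
Proof. exact: Defs.coord_basis. Qed.

Lemma coef_is_zmod_morphism k : zmod_morphism (coef k).
Proof.
move=> x y; rewrite /coef {1}(Defs.coord_basis x) {1}(Defs.coord_basis y).
rewrite -sumrB.
under eq_bigr do rewrite -mulrzBr.
exact: (Defs.coord_sum (fun j => Defs.coord x j - Defs.coord y j)).
Qed.

HB.instance Definition _ k :=
  GRing.isZmodMorphism.Build F int (coef k) (coef_is_zmod_morphism k).

Lemma coef_basis k i : coef k (basis i) = (k == i).
Proof.
rewrite /coef -(Defs.coord_sum (fun j => (j == i)%:Z)) (bigD1 i) //= eqxx mulr1z.
by rewrite big1 ?addr0 // => j /negPf->; rewrite mulr0z.
Qed.

Lemma coef_basisM i j k : coef k (basis i * basis j) = fcoef i j k.
Proof.
rewrite basisM; under eq_bigr do rewrite pmulrn.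
exact: (Defs.coord_sum (fun k => (fcoef i j k)%:Z)).
Qed.

Lemma zmod_morphism_expansion (V : zmodType) (f : F -> V) :
  zmod_morphism f -> forall x, f x = \sum_k f (basis k) *~ coef k x.
Proof.
move=> fB x; pose mf := GRing.isZmodMorphism.Build F V f fB.
pose g : {additive F -> V} := HB.pack f mf.
rewrite {1}(basis_expansion x) -[f]/(g : F -> V) raddf_sum.
by apply: eq_bigr => k _; rewrite raddfMz.
Qed.

Lemma zmod_morphism_basis_ext (V : zmodType) (f g : F -> V) :
  zmod_morphism f -> zmod_morphism g ->
  (forall i, f (basis i) = g (basis i)) -> f =1 g.
Proof.
move=> fB gB fg x; rewrite (zmod_morphism_expansion fB).
by rewrite (zmod_morphism_expansion gB); apply: eq_bigr => k _; rewrite fg.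
Qed.

Lemma coef_ext x y : (forall k, coef k x = coef k y) -> x = y.
Proof.
move=> xy; rewrite (basis_expansion x) (basis_expansion y).
by apply: eq_bigr => k _; rewrite xy.
Qed.

(* The coefficient of 1: a symmetrizing trace for which the bases b and b^*
   are dual. *)
Definition tau x := coef (idx1 F) x.

HB.instance Definition _ :=
  GRing.isZmodMorphism.Build F int tau (coef_is_zmod_morphism (idx1 F)).

Lemma tau_basisM i j : tau (basis i * basis j) = (i == dual j).
Proof. by rewrite /tau coef_basisM fcoef1; case: eqP. Qed.

Lemma tauC x y : tau (x * y) = tau (y * x).
Proof.
move: x; apply: zmod_morphism_basis_ext => [u v|u v|i].
- by rewrite mulrBl raddfB.
- by rewrite mulrBr raddfB.
move: y; apply: zmod_morphism_basis_ext => [u v|u v|j].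
- by rewrite mulrBr raddfB.
- by rewrite mulrBl raddfB.
rewrite !tau_basisM; congr (_%:Z).
by rewrite -(inj_eq (inv_inj (@dualK F))) dualK eq_sym.
Qed.

Lemma coef_tau k x : coef k x = tau (basis (dual k) * x).
Proof.
move: x; apply: zmod_morphism_basis_ext => [u v|u v|i].
- by rewrite raddfB.
- by rewrite mulrBr raddfB.
by rewrite coef_basis tau_basisM (inj_eq (inv_inj (@dualK F))).
Qed.

Definition star x := \sum_i basis (dual i) *~ coef i x.

Lemma star_is_zmod_morphism : zmod_morphism star.
Proof.
move=> x y; rewrite /star -sumrB; apply: eq_bigr => i _.
by rewrite raddfB mulrzBr.
Qed.

HB.instance Definition _ :=
  GRing.isZmodMorphism.Build F F star star_is_zmod_morphism.

Lemma starM x y : star (x * y) = star y * star x.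
Proof. exact: dual_antimorph. Qed.

Lemma star_basis i : star (basis i) = basis (dual i).
Proof.
rewrite /star (bigD1 i) //= coef_basis eqxx.
by rewrite big1 ?addr0 // => j ij; rewrite coef_basis (negPf ij).
Qed.

Lemma dual1 : dual (idx1 F) = idx1 F.
Proof.
apply/eqP; rewrite eq_sym; have := tau_basisM (idx1 F) (idx1 F).
by rewrite basis1 mulr1 -basis1 /tau coef_basis eqxx; case: eqP.
Qed.

Lemma tau_star x : tau (star x) = tau x.
Proof.
move: x; apply: zmod_morphism_basis_ext => [x y|x y|i]; rewrite ?raddfB //.
by rewrite star_basis /tau !coef_basis -{1}dual1 (inj_eq (inv_inj (@dualK F))).
Qed.

Lemma fcoef_frobenius i j k : fcoef (dual i) k j = fcoef i j k.
Proof.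
apply/eqP; rewrite -eqz_nat -!coef_basisM !coef_tau -[eqbRHS]tau_star !starM.
by rewrite !star_basis dualK tauC -!mulrA [eqbRHS]tauC !mulrA.
Qed.

Section Casimir.
Variables (V : zmodType) (B : F -> F -> V).
Hypothesis Bl : forall z, zmod_morphism (B^~ z).
Hypothesis Br : forall y, zmod_morphism (B y).

(* By duality of b and b^* for tau, sum b (x) b^* is a Casimir element. *)
Lemma casimirl x :
  \sum_i B (x * basis i) (basis (dual i)) =
  \sum_i B (basis i) (basis (dual i) * x).
Proof.
under eq_bigr => i _ do rewrite (zmod_morphism_expansion (Bl _)).
under [RHS]eq_bigr => i _ do rewrite (zmod_morphism_expansion (Br _)).
rewrite exchange_big; apply: eq_bigr => k _ /=.
rewrite [RHS](reindex_inj (inv_inj (@dualK F))); apply: eq_bigr => i _.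
by rewrite !coef_tau dualK mulrA tauC mulrA.
Qed.

Lemma casimirr x :
  \sum_i B (basis i * x) (basis (dual i)) =
  \sum_i B (basis i) (x * basis (dual i)).
Proof.
under eq_bigr => i _ do rewrite (zmod_morphism_expansion (Bl _)).
under [RHS]eq_bigr => i _ do rewrite (zmod_morphism_expansion (Br _)).
rewrite exchange_big; apply: eq_bigr => k _ /=.
rewrite [RHS](reindex_inj (inv_inj (@dualK F))); apply: eq_bigr => i _.
by rewrite !coef_tau dualK tauC mulrA.
Qed.

End Casimir.

End FusionRing.
Section Irreducible.
Variables (K : realType) (F : fusionRing).
Local Notation C := K[i].
Implicit Types (phi psi : irrep K F) (x y : F).

Local Notation "''rho_' phi" := (irrep_repr phi)
  (at level 8, phi at level 2, format "''rho_' phi").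

Lemma irrepM phi x y : 'rho_phi (x * y) = 'rho_phi x *m 'rho_phi y.
Proof. by rewrite rmorphM. Qed.

Lemma irrep1 phi : 'rho_phi 1 = 1%:M.
Proof. by rewrite rmorph1. Qed.

Section Schur.
Variables (phi psi : irrep K F).
Variable T : 'M[C]_((irrep_deg psi).+1, (irrep_deg phi).+1).
Hypothesis Tphi : forall x, T *m 'rho_phi x = 'rho_psi x *m T.

Lemma intertwiner_row_full : T != 0 -> row_full T.
Proof.
move=> T0; rewrite /row_full -mxrank_tr -/(row_free T^T) -kermx_eq0.
suff [->//|] : kermx T^T = 0 \/ row_full (kermx T^T).
  rewrite row_full_unit => kU; case/eqP: T0; apply: trmx_inj.
  by rewrite trmx0 -[T^T](mulKmx kU) mulmx_ker mulmx0.
apply: (@irrep_irr _ _ phi) => x; rewrite sub_kermx -mulmxA -trmx_mul Tphi.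
by rewrite trmx_mul mulmxA mulmx_ker mul0mx.
Qed.

Lemma intertwiner_row_free : T != 0 -> row_free T.
Proof.
move=> T0; rewrite /row_free -mxrank_tr.
have [|T0'|] := @irrep_irr _ _ psi <<T^T>>%MS.
- move=> x; rewrite (eqmx_stable _ (genmxE _)).
  by rewrite -trmx_mul -Tphi trmx_mul submxMl.
- case/eqP: T0; apply: trmx_inj; apply/eqP.
  by rewrite trmx0 -submx0 -T0' genmxE.
- by rewrite /row_full genmxE.
Qed.

Lemma intertwiner_iso : T != 0 -> irrep_iso phi psi.
Proof.
exists T; split=> //; first exact: intertwiner_row_free.
exact: intertwiner_row_full.
Qed.

End Schur.

Lemma irrep_iso_sym phi psi : irrep_iso phi psi -> irrep_iso psi phi.
Proof.
case=> P [Pfree Pfull PE].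
apply: (@intertwiner_iso _ _ (pinvmx P)) => [x|]; last first.
  apply: contraTneq Pfree => P0; have := mulVpmx Pfull; rewrite P0 mul0mx.
  by move/eqP; rewrite eq_sym (negPf (oner_neq0 _)).
rewrite -[LHS]mulmx1 -(mulmxVp Pfree) -!mulmxA (mulmxA _ P) -PE !mulmxA.
by rewrite mulVpmx // mul1mx.
Qed.

Lemma irrep_iso_trans phi psi theta :
  irrep_iso phi psi -> irrep_iso psi theta -> irrep_iso phi theta.
Proof.
case=> P [Pfree _ PE] [Q [Qfree _ QE]].
apply: (@intertwiner_iso _ _ (Q *m P)) => [x|].
  by rewrite -mulmxA PE !mulmxA QE.
apply: contraTneq Qfree => QP0.
by rewrite -[Q]mulmx1 -(mulmxVp Pfree) mulmxA QP0 mul0mx /row_free mxrank0.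
Qed.

Lemma schur_scalar phi (T : 'M[C]_((irrep_deg phi).+1)) :
  (forall x, T *m 'rho_phi x = 'rho_phi x *m T) -> exists a, T = a%:M.
Proof.
move=> Tphi.
have /closed_rootP[a] : size (char_poly T) != 1 by rewrite size_char_poly.
rewrite -eigenvalue_root_char => aT; exists a; apply/eqP; rewrite -subr_eq0.
apply: contraTT aT => Ta0; rewrite /eigenvalue negbK /eigenspace kermx_eq0.
apply: intertwiner_row_free Ta0 => x.
by rewrite mulmxBl mulmxBr Tphi scalar_mxC.
Qed.

Definition irrep_char phi x : C := \tr ('rho_phi x).

Lemma casimir_intertwiner phi psi M x
    (T := \sum_i 'rho_phi (basis i) *m M *m 'rho_psi (basis (dual i))) :
  T *m 'rho_psi x = 'rho_phi x *m T.
Proof.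
rewrite /T mulmx_sumr mulmx_suml.
under eq_bigr do rewrite -mulmxA -irrepM.
under [RHS]eq_bigr do rewrite !mulmxA -irrepM.
pose B y z := 'rho_phi y *m M *m 'rho_psi z.
rewrite -(@casimirl _ _ B) // => [z|y] u v; rewrite /B rmorphB /=.
  by rewrite !mulmxBl.
by rewrite mulmxBr.
Qed.

Lemma irrep_char_orthogonal phi psi : ~ irrep_iso psi phi ->
  \sum_i irrep_char phi (basis i) * irrep_char psi (basis (dual i)) = 0.
Proof.
move=> niso.
have T0 M : \sum_i 'rho_phi (basis i) *m M *m 'rho_psi (basis (dual i)) = 0.
  apply/eqP; apply/contraT => T0; case: niso; apply: intertwiner_iso T0.
  by move=> x; rewrite casimir_intertwiner.
transitivity (\sum_p \sum_q
    (\sum_i 'rho_phi (basis i) *m delta_mx p q *m 'rho_psi (basis (dual i)))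
      p q).
  under [RHS]eq_bigr do under eq_bigr do rewrite summxE.
  under [RHS]eq_bigr do rewrite exchange_big /=.
  rewrite exchange_big /=; apply: eq_bigr => i _.
  rewrite mulr_suml; apply: eq_bigr => p _.
  rewrite mulr_sumr; apply: eq_bigr => q _.
  rewrite mxE (bigD1 q) //= big1 => [|k /negPf kq]; rewrite !mxE.
    rewrite addr0 (bigD1 p) //= mxE !eqxx mulr1 big1 ?addr0 // => l /negPf lp.
    by rewrite mxE lp mulr0.
  by rewrite big1 ?mul0r // => l _; rewrite mxE kq andbF mulr0.
by rewrite big1 // => p _; rewrite big1 // => q _; rewrite T0 mxE.
Qed.

Lemma formal_codegree_exists phi : exists f, is_formal_codegree phi f.
Proof.
apply: schur_scalar => x; rewrite mulmx_sumr mulmx_suml.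
pose B y z := irrep_char phi y *: 'rho_phi z.
have Bl z : zmod_morphism (B^~ z).
  by move=> u v; rewrite /B /irrep_char rmorphB /= raddfB scalerBl.
have Br y : zmod_morphism (B y).
  by move=> u v; rewrite /B rmorphB scalerBr.
transitivity (\sum_i B (basis i) (basis (dual i) * x)).
  by apply: eq_bigr => i _; rewrite -scalemxAl -irrepM.
transitivity (\sum_i B (basis i) (x * basis (dual i))); last first.
  by apply: eq_bigr => i _; rewrite -scalemxAr -irrepM.
rewrite -casimirl // -casimirr //; apply: eq_bigr => i _.
by rewrite /B /irrep_char !irrepM mxtrace_mulC.
Qed.

Local Notation "A ^H" := (map_mx Num.conj A^T) (at level 8, format "A ^H").

Lemma adjointM m n p (A : 'M[C]_(m, n)) (B : 'M[C]_(n, p)) :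
  (A *m B)^H = B^H *m A^H.
Proof. by rewrite trmx_mul map_mxM. Qed.

Lemma row_adjoint_ge0 n (v : 'rV[C]_n) : 0 <= (v *m v^H) 0 0.
Proof.
by rewrite mxE sumr_ge0 // => j _; rewrite !mxE mul_conjC_ge0.
Qed.

Lemma row_adjoint_eq0 n (v : 'rV[C]_n) : (v *m v^H) 0 0 = 0 -> v = 0.
Proof.
rewrite mxE => /eqP; rewrite psumr_eq0 => [/allP v0|j _]; last first.
  by rewrite !mxE mul_conjC_ge0.
apply/rowP => j; apply/eqP; rewrite mxE.
by have := v0 j (mem_index_enum _); rewrite !mxE mul_conjC_eq0.
Qed.

(* The average H of the forms phi(b)^H phi(b) is positive definite and
   satisfies phi(x)^H H = H phi(x^* ), so phi(x)^H and phi(x^* ) are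
   conjugate. *)
Lemma irrep_char_star phi x : irrep_char phi (star x) = (irrep_char phi x)^*%R.
Proof.
pose H := \sum_i ('rho_phi (basis i))^H *m 'rho_phi (basis i).
have Hx : ('rho_phi x)^H *m H = H *m 'rho_phi (star x).
  pose B y z := ('rho_phi y)^H *m 'rho_phi (star z).
  transitivity (\sum_i B (basis i * x) (basis (dual i))).
    rewrite mulmx_sumr; apply: eq_bigr => i _.
    by rewrite /B mulmxA star_basis dualK -adjointM irrepM.
  rewrite casimirr => [|z u v|y u v]; last 2 first.
  - by rewrite /B rmorphB /= linearB /= map_mxB mulmxBl.
  - by rewrite /B raddfB rmorphB mulmxBr.
  rewrite mulmx_suml; apply: eq_bigr => i _.
  by rewrite /B starM star_basis dualK irrepM mulmxA.
have Hunit : H \in unitmx.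
  rewrite -row_free_unit -kermx_eq0; apply/eqP/row_matrixP => r; rewrite row0.
  set v := row r _; apply: row_adjoint_eq0; apply/eqP.
  pose w i := v *m ('rho_phi (basis i))^H.
  have vH : \sum_i (w i *m (w i)^H) 0 0 == 0.
    have vHv : (v *m H *m v^H) 0 0 = 0.
      by rewrite /v -row_mul mulmx_ker row0 mul0mx mxE.
    apply/eqP; rewrite -[RHS]vHv mulmx_sumr mulmx_suml summxE.
    apply: eq_bigr => i _; rewrite adjointM; congr ((_ : 'M_1) 0 0).
    rewrite !mulmxA; congr (_ *m _ *m _).
    by apply/matrixP => a b; rewrite !mxE conjCK.
  move: vH; rewrite psumr_eq0 => [/allP/(_ (idx1 F))|i _]; last first.
    exact: row_adjoint_ge0.
  by rewrite /w mem_index_enum basis1 irrep1 trmx1 map_mx1 mulmx1; apply.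
have -> : (irrep_char phi x)^*%R = \tr ('rho_phi x)^H.
  rewrite /irrep_char /mxtrace rmorph_sum.
  by apply: eq_bigr => i _; rewrite !mxE.
by rewrite -[('rho_phi x)^H](mulmxK Hunit) Hx mxtrace_mulC mulKmx //.
Qed.

Lemma irrep_char_norm_neq0 phi :
  \sum_i irrep_char phi (basis i) * irrep_char phi (basis (dual i)) != 0.
Proof.
under eq_bigr do rewrite -star_basis irrep_char_star.
rewrite psumr_eq0 => [|i _]; last exact: mul_conjC_ge0.
apply/allPn; exists (idx1 F); first exact: mem_index_enum.
by rewrite mul_conjC_eq0 basis1 /irrep_char irrep1 mxtrace1 pnatr_eq0.
Qed.

Lemma irrep_count m (phi : 'I_m -> irrep K F) :
  (forall i j, irrep_iso (phi i) (phi j) -> i = j) -> (m <= rk F)%N.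
Proof.
move=> phi_inj.
pose X : 'M[C]_(m, rk F) := \matrix_(i, b) irrep_char (phi i) (basis b).
pose Y : 'M[C]_(rk F, m) := \matrix_(b, j) irrep_char (phi j) (basis (dual b)).
pose D := \row_j (X *m Y) j j.
have XY : X *m Y = diag_mx D.
  apply/matrixP => i j; rewrite !mxE; have [->|ij] := eqVneq i j.
    by rewrite mulr1n.
  rewrite mulr0n; under eq_bigr do rewrite !mxE.
  by apply: irrep_char_orthogonal => /phi_inj ji; rewrite ji eqxx in ij.
have <- : \rank (X *m Y) = m.
  apply/eqP; rewrite -/(row_free _) row_free_unit unitmxE XY det_diag unitfE.
  apply/prodf_neq0 => i _; rewrite !mxE; under eq_bigr do rewrite !mxE.
  exact: irrep_char_norm_neq0.
exact: leq_trans (mxrankM_maxl _ _) (rank_leq_col _).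
Qed.

(* A family of pairwise non-isomorphic irreducible representations extends to
   a complete one, because its length is bounded by rk F. *)
Lemma irrep_family_complete phi0 : exists m (phi : nat -> irrep K F),
  [/\ phi 0%N = phi0,
      forall i j, (i <= m)%N -> (j <= m)%N ->
        irrep_iso (phi i) (phi j) -> i = j &
      forall psi, exists2 i, (i <= m)%N & irrep_iso psi (phi i)].
Proof.
pose P m := exists phi : nat -> irrep K F, phi 0%N = phi0 /\
  forall i j, (i <= m)%N -> (j <= m)%N -> irrep_iso (phi i) (phi j) -> i = j.
have [m [phi [phi00 phi_inj]] mmax] : exists2 m, P m & ~ P m.+1.
  apply: contrapT => noP.
  have allP m : P m.
    elim: m => [|m IHm]; first by exists (fun=> phi0); split=> // -[|//] [].
    by apply: contrapT => nPm; apply: noP; exists m.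
  have [phi [_ phi_inj]] := allP (rk F).
  suff : ((rk F).+1 <= rk F)%N by rewrite ltnn.
  apply: (@irrep_count _ (fun i : 'I_(rk F).+1 => phi i)) => i j /phi_inj ij.
  by apply: val_inj; apply: ij; rewrite -ltnS ltn_ord.
exists m, phi; split=> // psi; apply: contrapT => npsi; apply: mmax.
exists (fun i => if (i <= m)%N then phi i else psi); split=> // i j.
rewrite leq_eqVlt ltnS [(j <= _)%N]leq_eqVlt ltnS.
case/predU1P=> [->|im]; case/predU1P=> [->//|jm]; rewrite ?ltnn ?im ?jm.
- by move=> iso; case: npsi; exists j.
- by move=> /irrep_iso_sym iso; case: npsi; exists i.
- exact: phi_inj.
Qed.

End Irreducible.

Section ScalarRepresentations.
Variables (K : realType) (F : fusionRing).
Local Notation C := K[i].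
Implicit Types (phi psi : irrep K F).

Lemma scalar_mx_irreducible (chi : F -> C) :
  @irreducible_repr K F 0 (fun x => (chi x)%:M).
Proof.
move=> U _; have [->|U0] := eqVneq U 0; [by left|right].
rewrite row_full_unit unitmxE unitfE det_mx11.
by apply: contra_neq U0 => U00; rewrite [U]mx11_scalar U00 raddf0.
Qed.

Definition linear_irrep (chi : {rmorphism F -> C}) : irrep K F :=
  @Irrep K F 0 (scalar_mx \o chi : {rmorphism F -> 'M[C]_1})
    (@scalar_mx_irreducible chi).

Lemma scalar_irrep_iso phi psi (chi : F -> C) :
    (forall x, irrep_repr phi x = (chi x)%:M) ->
    (forall x, irrep_repr psi x = (chi x)%:M) ->
  irrep_iso phi psi.
Proof.
move=> phiE psiE; apply: (@intertwiner_iso _ _ _ _ (const_mx 1)) => [x|].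
  by rewrite phiE psiE scalar_mxC.
by apply/eqP => /matrixP/(_ ord0 ord0)/eqP; rewrite !mxE oner_eq0.
Qed.

Lemma irrep_iso_scalar phi psi x a b : irrep_iso phi psi ->
  irrep_repr phi x = a%:M -> irrep_repr psi x = b%:M -> a = b.
Proof.
case=> P [Pfree _ /(_ x) PE] phix psix; apply/eqP; rewrite -subr_eq0.
have : (a - b) *: P == 0.
  by rewrite scalerBl -mul_mx_scalar -mul_scalar_mx -phix -psix PE subrr.
rewrite scalemx_eq0 => /orP[//|/eqP P0].
by move: Pfree; rewrite P0 /row_free mxrank0.
Qed.

Lemma linear_irrep_codegree (chi : {rmorphism F -> C}) f :
  \sum_i chi (basis i) * chi (basis (dual i)) = f ->
  is_formal_codegree (linear_irrep chi) f.
Proof.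
move<-; rewrite /is_formal_codegree raddf_sum; apply: eq_bigr => i _ /=.
by rewrite mxtrace_scalar mulr1n scale_scalar_mx.
Qed.

End ScalarRepresentations.

Section NearIntegral.
Variables (R S : fusionRing) (incl : fusionInclusion S R).
Hypothesis near_integral : (rk S + 1 = rk R)%N.
Variable rho : 'I_(rk R).
Hypothesis rhoP : forall i : 'I_(rk S), incl_idx incl i <> rho.
Local Notation iota := (incl_idx incl).
Local Notation inc := (incl_ring incl).
Local Notation r := (basis rho).
Local Notation kappa := (fcoef rho rho rho).
Implicit Types (x y : S) (i j k : 'I_(rk S)).

Lemma iota_neq_rho i : (iota i == rho) = false.
Proof. exact/eqP. Qed.

Lemma sum_near_integral (V : nmodType) (G : 'I_(rk R) -> V) :
  \sum_i G i = G rho + \sum_j G (iota j).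
Proof.
rewrite (bigD1 rho) //=; congr (_ + _).
rewrite -[RHS](big_imset G (in2W (@incl_idx_inj _ _ incl)) (A := predT)) /=.
have -> : imset iota (mem predT) = ~: finset.set1 rho.
  apply/eqP; rewrite eqEcard; apply/andP; split.
    by apply/fintype.subsetP => _ /imsetP[j _ ->]; rewrite !inE iota_neq_rho.
  rewrite cardsC1 card_imset; last exact: incl_idx_inj.
  rewrite (eq_card (B := {: 'I_(rk S)})) //.
  by rewrite !card_ord -near_integral addn1.
by apply: eq_bigl => i; rewrite !inE.
Qed.

Lemma idx_near_integral (P : 'I_(rk R) -> Prop) :
  P rho -> (forall j, P (iota j)) -> forall l, P l.
Proof.
move=> Prho Piota l.
have [->//|lr] := eqVneq l rho.
have := sum_near_integral (fun m : 'I_(rk R) => (m == l) : nat).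
rewrite (bigD1 l) //= eqxx [rho == l]eq_sym (negPf lr) add0r.
have [j /eqP<- //|no] := pickP (fun j => iota j == l).
by rewrite [RHS]big1 // => j _; rewrite no.
Qed.

Lemma coef_iota k x : coef (iota k) (inc x) = coef k x.
Proof.
move: x; apply: zmod_morphism_basis_ext => [x y|x y|i];
  rewrite ?rmorphB ?raddfB //.
by rewrite incl_basis !coef_basis (inj_eq (@incl_idx_inj _ _ incl)).
Qed.

Lemma coef_rho_incl x : coef rho (inc x) = 0.
Proof.
move: x; apply: (@zmod_morphism_basis_ext _ _ _ (fun=> 0)) => [x y|x y|i].
- by rewrite rmorphB raddfB.
- by rewrite subr0.
- by rewrite incl_basis coef_basis eq_sym iota_neq_rho.
Qed.

Lemma incl_inj : injective inc.
Proof.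
by move=> x y xy; apply: coef_ext => k; rewrite -!coef_iota xy.
Qed.

Lemma iota1 : iota (idx1 S) = idx1 R.
Proof.
apply/eqP; have := coef_basis (iota (idx1 S)) (idx1 R).
rewrite basis1 -(rmorph1 inc) -basis1 incl_basis coef_basis eqxx.
by case: eqP.
Qed.

Lemma tau_incl x : tau (inc x) = tau x.
Proof. by rewrite /tau -iota1 coef_iota. Qed.

Lemma dual_iota j : dual (iota j) = iota (dual j).
Proof.
apply/eqP; rewrite eq_sym; have := tau_basisM (iota (dual j)) (iota j).
by rewrite -!incl_basis -rmorphM tau_incl tau_basisM eqxx; case: eqP.
Qed.

Lemma dual_rho : dual rho = rho.
Proof.
apply/eqP; suff : forall l, dual rho = l -> l == rho by apply.
apply: idx_near_integral => // j /(congr1 (@dual R)); rewrite dualK dual_iota.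
by move/eqP; rewrite eq_sym iota_neq_rho.
Qed.

Lemma tau_incl_rho x : tau (inc x * r) = 0.
Proof.
by rewrite tauC -{1}dual_rho -coef_tau coef_rho_incl.
Qed.

Definition fpdim_fun x : int := tau (inc x * r * r).

Lemma incl_mul_rho x : inc x * r = r *~ fpdim_fun x.
Proof.
apply: coef_ext; apply: idx_near_integral => [|k];
  rewrite raddfMz /= coef_basis.
  by rewrite eqxx intz coef_tau dual_rho tauC.
rewrite iota_neq_rho mul0rz coef_tau dual_iota -incl_basis mulrA -rmorphM.
exact: tau_incl_rho.
Qed.

Lemma rho_mul_incl x : r * inc x = r *~ fpdim_fun x.
Proof.
apply: coef_ext; apply: idx_near_integral => [|k];
  rewrite raddfMz /= coef_basis.
  by rewrite eqxx intz coef_tau dual_rho mulrA tauC mulrA.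
rewrite iota_neq_rho mul0rz coef_tau dual_iota -incl_basis mulrA tauC mulrA -rmorphM.
exact: tau_incl_rho.
Qed.

Lemma rho_mulz_inj : injective (fun n : int => r *~ n).
Proof.
by move=> m n /(congr1 (coef rho)); rewrite !raddfMz /= coef_basis eqxx !intz.
Qed.

Lemma fpdim_is_zmod_morphism : zmod_morphism fpdim_fun.
Proof. by move=> x y; rewrite /fpdim_fun rmorphB !mulrBl raddfB. Qed.

Lemma fpdim_is_monoid_morphism : monoid_morphism fpdim_fun.
Proof.
split=> [|x y]; apply: rho_mulz_inj; rewrite -incl_mul_rho.
  by rewrite rmorph1 mul1r.
by rewrite rmorphM -mulrA incl_mul_rho mulrzAr incl_mul_rho -mulrzA.
Qed.

Definition fpdim : {rmorphism S -> int} :=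
  HB.pack fpdim_fun (GRing.isZmodMorphism.Build S int _ fpdim_is_zmod_morphism)
    (GRing.isMonoidMorphism.Build S int _ fpdim_is_monoid_morphism).

Arguments fpdim : simpl never.

Lemma fpdim_star x : fpdim (star x) = fpdim x.
Proof.
apply: rho_mulz_inj; rewrite -rho_mul_incl.
have -> : inc (star x) = star (inc x).
  move: x; apply: zmod_morphism_basis_ext => [x y|x y|i].
  - by rewrite !raddfB.
  - by rewrite rmorphB raddfB.
  - by rewrite star_basis !incl_basis star_basis dual_iota.
have <- : star r = r by rewrite star_basis dual_rho.
by rewrite -starM incl_mul_rho raddfMz.
Qed.

Lemma fpdim_dual i : fpdim (basis (dual i)) = fpdim (basis i).
Proof. by rewrite -star_basis fpdim_star. Qed.

Lemma fpdim_expansion x : fpdim x = \sum_k fpdim (basis k) *~ coef k x.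
Proof. by apply: zmod_morphism_expansion; apply: fpdim_is_zmod_morphism. Qed.

Lemma fpdim_basis_ge0 i : 0 <= fpdim (basis i).
Proof.
have := congr1 (coef rho) (incl_mul_rho (basis i)).
rewrite incl_basis coef_basisM raddfMz /= coef_basis eqxx intz => H.
by rewrite /fpdim /= -H.
Qed.

Lemma fpdim_basis_gt0 i : 0 < fpdim (basis i).
Proof.
rewrite lt_def fpdim_basis_ge0 andbT; apply/eqP => fi0.
suff : 1 <= fpdim (basis (dual i) * basis i).
  by rewrite rmorphM fi0 mulr0.
rewrite fpdim_expansion (bigD1 (idx1 S)) //.
rewrite basis1 rmorph1.
rewrite -/(tau _) tau_basisM eqxx lerDl sumr_ge0 // => k _.
by rewrite coef_basisM -pmulrn mulrn_wge0 // fpdim_basis_ge0.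
Qed.

Definition regular := \sum_i basis i *~ fpdim (basis i).

Lemma coef_regular k : coef k regular = fpdim (basis k).
Proof.
rewrite raddf_sum (bigD1 k) //= raddfMz /= coef_basis eqxx intz.
rewrite big1 ?addr0 // => i ik.
by rewrite raddfMz /= coef_basis eq_sym (negPf ik) mul0rz.
Qed.

Lemma rho_squared : r * r = r *~ kappa + inc regular.
Proof.
apply: coef_ext; apply: idx_near_integral => [|k];
  rewrite raddfD raddfMz /= coef_basis.
  by rewrite coef_basisM eqxx intz coef_rho_incl addr0.
rewrite iota_neq_rho mul0rz add0r coef_iota coef_regular -fpdim_dual.
by rewrite coef_tau dual_iota mulrA -incl_basis.
Qed.

Lemma mul_regular x : x * regular = regular *~ fpdim x.
Proof.
apply: incl_inj; rewrite rmorphM [RHS]raddfMz /=.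
have -> : inc regular = r * r - r *~ kappa by rewrite rho_squared addrC addKr.
rewrite mulrBr mulrA mulrzAr incl_mul_rho mulrzAl mulrzBl -!mulrzA.
by rewrite [_ * kappa%:Z]mulrC.
Qed.

Lemma fpdim_regular : fpdim regular = \sum_i fpdim (basis i) ^+ 2.
Proof.
rewrite rmorph_sum; apply: eq_bigr => i _.
by rewrite raddfMz /= -mulrzr intz expr2.
Qed.

Lemma fpdim_regular_gt0 : 0 < fpdim regular.
Proof.
rewrite fpdim_regular (bigD1 (idx1 S)) //= ltr_wpDr ?exprn_gt0 ?fpdim_basis_gt0 //.
by rewrite sumr_ge0 // => i _; rewrite exprn_ge0 ?fpdim_basis_ge0.
Qed.

Definition proj (z : R) : S := \sum_j basis j *~ coef (iota j) z.

Lemma proj_is_zmod_morphism : zmod_morphism proj.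
Proof.
move=> y z; rewrite /proj -sumrB; apply: eq_bigr => i _.
by rewrite raddfB mulrzBr.
Qed.

Lemma proj_incl x a : proj (inc x + r *~ a) = x.
Proof.
rewrite [RHS]basis_expansion; apply: eq_bigr => k _.
by rewrite raddfD raddfMz /= coef_iota coef_basis iota_neq_rho mul0rz addr0.
Qed.

Lemma coef_rho_decomposition x a : coef rho (inc x + r *~ a) = a.
Proof. by rewrite raddfD raddfMz /= coef_rho_incl coef_basis eqxx intz add0r. Qed.

Lemma near_integral_decomposition z : z = inc (proj z) + r *~ coef rho z.
Proof.
rewrite {1}(basis_expansion z) sum_near_integral addrC; congr (_ + _).
rewrite rmorph_sum; apply: eq_bigr => j _.
by rewrite raddfMz /= incl_basis.
Qed.

Lemma near_integralM x y a b :
  (inc x + r *~ a) * (inc y + r *~ b) =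
  inc (x * y + regular *~ (a * b)) +
  r *~ (fpdim x * b + a * fpdim y + kappa%:Z * (a * b)).
Proof.
rewrite mulrDl !mulrDr !mulrzAr !mulrzAl incl_mul_rho rho_mul_incl rho_squared.
rewrite rmorphD rmorphM raddfMz /= !mulrzDl !mulrzDr -!mulrzA.
rewrite [fpdim_fun y * a]mulrC -!addrA; congr (_ + _).
by rewrite [RHS]addrC -!addrA.
Qed.


Variable K : realType.
Local Notation C := K[i].

(* The vector (fpdim b)_b is a positive eigenvector of every fusion matrix,
   and pairing with it bounds all the other real eigenvalues. *)
Lemma FPdim_fpdim i : FPdim K i = (fpdim (basis i))%:~R.
Proof.
pose n k : K := (fpdim (basis k))%:~R.
have n_gt0 k : 0 < n k by rewrite ltr0z fpdim_basis_gt0.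
have nM l k : n l * n k = \sum_j (fcoef l k j)%:R * n j.
  rewrite /n -rmorphM -rmorphM fpdim_expansion rmorph_sum; apply: eq_bigr => j _.
  by rewrite coef_basisM -pmulrn rmorphMn /= mulr_natl.
have n_eigen : eigenvalue (fusion_mx K i) (n i).
  apply/eigenvalueP; exists (\row_k n k); last first.
    apply/eqP => /rowP/(_ i); rewrite !mxE => ni0.
    by have := n_gt0 i; rewrite ni0 ltxx.
  apply/rowP => k; rewrite !mxE.
  have -> : n i = n (dual i) by rewrite /n fpdim_dual.
  rewrite nM; apply: eq_bigr => j _; rewrite !mxE mulrC.
  by rewrite -fcoef_frobenius.
  have n_max a : eigenvalue (fusion_mx K i) a -> a <= n i.
  case/eigenvalueP => v va v0.
  pose q := \sum_k `|v 0 k| * n k.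
  have q_gt0 : 0 < q.
    have [k vk] : exists k, v 0 k != 0.
      apply/existsP; rewrite -negb_forall; apply: contra v0 => /forallP v0.
      by apply/eqP/rowP => k; rewrite mxE; apply/eqP.
    rewrite /q (bigD1 k) //= ltr_wpDr ?mulr_gt0 ?normr_gt0 //.
    by rewrite sumr_ge0 // => l _; rewrite mulr_ge0 // ltW.
  apply: le_trans (ler_norm a) _; rewrite -(ler_pM2r q_gt0) {1}/q mulr_sumr.
  have -> : n i * q = \sum_k (\sum_j `|v 0 j| * (fcoef i j k)%:R) * n k.
    under eq_bigr do rewrite mulr_suml.
    rewrite exchange_big mulr_sumr; apply: eq_bigr => j _.
    rewrite mulrCA nM mulr_sumr; apply: eq_bigr => k _.
    by rewrite mulrA.
  apply: ler_sum => k _; rewrite mulrA ler_pM2r //.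
  have := congr1 (fun w : 'rV_ _ => w 0 k) va; rewrite !mxE -normrM => <-.
  apply: le_trans (ler_norm_sum _ _ _) _; apply: ler_sum => j _.
  by rewrite normrM !mxE normr_nat.
apply/eqP; rewrite eq_le; apply/andP; split; last first.
  by apply: ub_le_sup => //; exists (n i).
by apply: ge_sup => //; exists (n i).
Qed.

Lemma FPdim_ring_regular : FPdim_ring K S = (fpdim regular)%:~R.
Proof.
rewrite fpdim_regular rmorph_sum; apply: eq_bigr => i _.
by rewrite FPdim_fpdim rmorphXn.
Qed.

Definition fpdim_char : {rmorphism S -> C} := intr \o fpdim.

Lemma fpdim_charE x : fpdim_char x = (fpdim x)%:~R.
Proof. by []. Qed.

Lemma fpdim_char_codegree :
  is_formal_codegree (linear_irrep fpdim_char) (FPdim_ring K S)%:C.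
Proof.
apply: linear_irrep_codegree; rewrite FPdim_ring_regular rmorph_int fpdim_regular.
rewrite rmorph_sum; apply: eq_bigr => i _.
by rewrite !fpdim_charE fpdim_dual -rmorphM expr2.
Qed.

Section ZeroExtension.
Variable phi : irrep K S.
Hypothesis phi_regular : irrep_repr phi regular = 0.

Definition zero_ext_fun z := irrep_repr phi (proj z).

Lemma zero_ext_is_zmod_morphism : zmod_morphism zero_ext_fun.
Proof. by move=> y z; rewrite /zero_ext_fun proj_is_zmod_morphism rmorphB. Qed.

Lemma zero_ext_is_monoid_morphism : monoid_morphism zero_ext_fun.
Proof.
split=> [|y z]; rewrite /zero_ext_fun.
  by rewrite -(rmorph1 inc) -[inc 1]addr0 -(mulr0z r) proj_incl rmorph1.
rewrite {1}(near_integral_decomposition y) {1}(near_integral_decomposition z).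
rewrite near_integralM proj_incl rmorphD raddfMz /= phi_regular mul0rz addr0.
by rewrite rmorphM.
Qed.

Definition zero_ext_repr : {rmorphism R -> 'M[C]_((irrep_deg phi).+1)} :=
  HB.pack zero_ext_fun
    (GRing.isZmodMorphism.Build _ _ zero_ext_fun zero_ext_is_zmod_morphism)
    (GRing.isMonoidMorphism.Build _ _ zero_ext_fun zero_ext_is_monoid_morphism).

Lemma zero_ext_repr_incl x : zero_ext_repr (inc x) = irrep_repr phi x.
Proof. by rewrite /= /zero_ext_fun -[inc x]addr0 -(mulr0z r) proj_incl. Qed.

Lemma zero_ext_repr_rho : zero_ext_repr r = 0.
Proof.
rewrite /= /zero_ext_fun -[r]mulr1z -[_ *~ 1]add0r -(rmorph0 inc).
by rewrite proj_incl rmorph0.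
Qed.

Lemma zero_ext_irreducible : irreducible_repr zero_ext_repr.
Proof.
move=> U Ustable; apply: (@irrep_irr _ _ phi) => x.
by rewrite -zero_ext_repr_incl Ustable.
Qed.

Definition zero_ext : irrep K R := Irrep zero_ext_irreducible.

Lemma zero_ext_codegree f : is_formal_codegree phi f -> is_formal_codegree zero_ext f.
Proof.
rewrite /is_formal_codegree sum_near_integral /= -/zero_ext_repr => <-.
rewrite -[zero_ext_fun]/(zero_ext_repr : R -> _).
rewrite zero_ext_repr_rho mxtrace0 scale0r add0r; apply: eq_bigr => i _.
by rewrite dual_iota -!incl_basis !zero_ext_repr_incl.
Qed.

End ZeroExtension.

Lemma zero_ext_iso phi psi phi0 psi0 :
  irrep_iso (@zero_ext phi phi0) (@zero_ext psi psi0) <-> irrep_iso phi psi.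
Proof.
split=> -[P [Pfree Pfull PE]]; exists P; split=> // x; last exact: PE.
by have := PE (inc x); rewrite /= /zero_ext_fun -[inc x]addr0 -(mulr0z r) proj_incl.
Qed.

(* x * regular = fpdim x * regular, so the image of phi(regular) is a
   subrepresentation on which x acts by fpdim x. *)
Lemma irrep_regular phi :
  ~ irrep_iso phi (linear_irrep fpdim_char) <-> irrep_repr phi regular = 0.
Proof.
split=> [niso|phi0 iso]; last first.
  have := irrep_iso_scalar iso (x := regular) (a := 0) (b := fpdim_char regular).
  rewrite phi0 raddf0 => /(_ erefl erefl)/esym/eqP.
  by rewrite intr_eq0 gt_eqF // fpdim_regular_gt0.
apply/eqP/contraT => phi0; case: niso.
have phi_reg x : irrep_repr phi x *m irrep_repr phi regular =
    fpdim_char x *: irrep_repr phi regular.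
  by rewrite -irrepM mul_regular raddfMz /= scaler_int.
have reg_full : row_full (irrep_repr phi regular)^T.
  have [x||//] := @irrep_irr _ _ phi (irrep_repr phi regular)^T.
    by rewrite -trmx_mul phi_reg linearZ scalemx_sub.
  by move=> reg0; rewrite -[irrep_repr _ _]trmxK reg0 trmx0 eqxx in phi0.
have reg_unit : irrep_repr phi regular \in unitmx.
  by rewrite -unitmx_tr -row_full_unit.
apply: (@scalar_irrep_iso _ _ _ _ fpdim_char) => // x.
by rewrite -[LHS](mulmxK reg_unit) phi_reg -scalemxAl mulmxV // scalemx1.
Qed.

Section RhoCharacter.
Variable t : C.
Hypothesis tP : t ^+ 2 = kappa%:R * t + (fpdim regular)%:~R.

Definition rho_char_fun z : C := (fpdim (proj z))%:~R + (coef rho z)%:~R * t.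

Lemma rho_charE x a : rho_char_fun (inc x + r *~ a) = (fpdim x)%:~R + a%:~R * t.
Proof. by rewrite /rho_char_fun proj_incl coef_rho_decomposition. Qed.

Lemma rho_char_is_zmod_morphism : zmod_morphism rho_char_fun.
Proof.
move=> y z; rewrite /rho_char_fun proj_is_zmod_morphism !raddfB /= mulrBl.
by rewrite opprD addrACA.
Qed.

Lemma rho_char_is_monoid_morphism : monoid_morphism rho_char_fun.
Proof.
split=> [|y z].
  by rewrite -(rmorph1 inc) -[inc 1]addr0 -(mulr0z r) rho_charE rmorph1 mul0r addr0.
rewrite (near_integral_decomposition y) (near_integral_decomposition z).
set a := coef _ y; set b := coef _ z; rewrite near_integralM !rho_charE.
rewrite rmorphD rmorphM raddfMz /= mulrzz !rmorphD !rmorphM /=.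
have tP' : t ^+ 2 = kappa%:Z%:~R * t + (fpdim_fun regular)%:~R by rewrite tP pmulrn.
ring: tP'.
Qed.

Definition rho_char : {rmorphism R -> C} :=
  HB.pack rho_char_fun
    (GRing.isZmodMorphism.Build _ _ rho_char_fun rho_char_is_zmod_morphism)
    (GRing.isMonoidMorphism.Build _ _ rho_char_fun rho_char_is_monoid_morphism).

Lemma rho_char_incl x : rho_char (inc x) = (fpdim x)%:~R.
Proof. by rewrite /= -[inc x]addr0 -(mulr0z r) rho_charE mul0r addr0. Qed.

Lemma rho_char_rho : rho_char r = t.
Proof.
rewrite /= -[r]mulr1z -[_ *~ 1]add0r -(rmorph0 inc).
by rewrite rho_charE rmorph0 add0r mul1r.
Qed.

Lemma rho_char_codegree :
  is_formal_codegree (linear_irrep rho_char) ((fpdim regular)%:~R + t ^+ 2).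
Proof.
apply: linear_irrep_codegree; rewrite sum_near_integral dual_rho rho_char_rho.
rewrite addrC -expr2 fpdim_regular rmorph_sum; congr (_ + _); apply: eq_bigr => i _.
by rewrite dual_iota -!incl_basis !rho_char_incl fpdim_dual -rmorphM expr2.
Qed.

End RhoCharacter.

(* rho is central, so psi(rho) is a scalar t; when t <> 0, the relation
   x rho = fpdim(x) rho makes psi(x) scalar too. *)
Lemma irrep_near_integral (psi : irrep K R) :
  (exists phi phi0, irrep_iso psi (@zero_ext phi phi0)) \/
  (exists t tP, forall z, irrep_repr psi z = (@rho_char t tP z)%:M).
Proof.
have psi_reg : irrep_repr psi r *m irrep_repr psi r =
    kappa%:R *: irrep_repr psi r + irrep_repr psi (inc regular).
  by rewrite -irrepM rho_squared rmorphD raddfMz /= -pmulrn scaler_nat.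
have [psi_rho|psi_rho] := eqVneq (irrep_repr psi r) 0; [left|right].
  have psiE z : irrep_repr psi z = irrep_repr psi (inc (proj z)).
    rewrite {1}(near_integral_decomposition z) rmorphD /= raddfMz /= psi_rho.
    by rewrite mul0rz addr0.
  have irr : irreducible_repr (irrep_repr psi \o inc : {rmorphism S -> _}).
    move=> U Ustable; apply: (@irrep_irr _ _ psi) => z.
    by rewrite psiE; exact: Ustable.
  have reg0 : irrep_repr (Irrep irr) regular = 0.
    by move/eqP: psi_reg; rewrite psi_rho mul0mx scaler0 add0r eq_sym => /eqP.
  exists (Irrep irr), reg0.
  pose T : 'M[C]_((irrep_deg psi).+1) := 1%:M.
  apply: (@intertwiner_iso _ _ psi (zero_ext reg0) T) => [z|].
    by rewrite mulmx1 mul1mx psiE.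
  exact: oner_neq0.
have [t tE] : exists t, irrep_repr psi r = t%:M.
  apply: schur_scalar => z; rewrite -!irrepM; congr (irrep_repr psi _).
  rewrite (near_integral_decomposition z) mulrDl mulrDr incl_mul_rho rho_mul_incl.
  by rewrite mulrzAl mulrzAr.
have t0 : t != 0 by apply: contra_neq psi_rho => t0; rewrite tE t0 raddf0.
have psi_incl x : irrep_repr psi (inc x) = (fpdim x)%:~R%:M.
  apply: (scalerI t0); rewrite -mul_mx_scalar -tE -irrepM incl_mul_rho.
  by rewrite raddfMz /= tE scale_scalar_mx -raddfMz /= -mulrzr.
have tP : t ^+ 2 = kappa%:R * t + (fpdim regular)%:~R.
  move: psi_reg; rewrite tE psi_incl -scalar_mxM scale_scalar_mx -raddfD /=.
  by move/matrixP/(_ ord0 ord0); rewrite !mxE eqxx !mulr1n expr2.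
exists t, tP => z.
rewrite {1}(near_integral_decomposition z) rmorphD raddfMz /= psi_incl tE.
by rewrite /rho_char_fun raddfD /= mulrzl !raddfMz.
Qed.

End NearIntegral.

Theorem corollary3p5 (K : realType) (R S : fusionRing)
    (incl : fusionInclusion S R) (near_integral : (rk S + 1 = rk R)%N)
    (rho : 'I_(rk R)) (rhoP : forall i : 'I_(rk S), incl_idx incl i <> rho)
    (dp dm : K) (dp_gt0 : 0 < dp) (dm_lt0 : dm < 0)
    (dpP : dp ^+ 2 - (fcoef rho rho rho)%:R * dp - FPdim_ring K S = 0)
    (dmP : dm ^+ 2 - (fcoef rho rho rho)%:R * dm - FPdim_ring K S = 0) :
  exists2 s : seq K[i],
    formal_codegrees S ((FPdim_ring K S)%:C :: s) &
    formal_codegrees R [:: (FPdim_ring K S + dp ^+ 2)%:C,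
                           (FPdim_ring K S + dm ^+ 2)%:C & s].
Proof.
pose chi := fpdim_char near_integral rhoP K.
pose lam := regular near_integral rhoP.
pose D := (fpdim near_integral rhoP lam)%:~R : K.
have DE : FPdim_ring K S = D by exact: FPdim_ring_regular.
have rootC (d : K) : d ^+ 2 - (fcoef rho rho rho)%:R * d - FPdim_ring K S = 0 ->
    (d%:C) ^+ 2 = (fcoef rho rho rho)%:R * d%:C +
      (fpdim near_integral rhoP lam)%:~R.
  rewrite DE -addrA -opprD => /eqP; rewrite subr_eq0.
  move=> /eqP/(congr1 (real_complex K)).
  by rewrite rmorphXn rmorphD rmorphM rmorph_nat rmorph_int.
have dpC := rootC _ dpP; have dmC := rootC _ dmP.
pose psip := linear_irrep (rho_char dpC).
pose psim := linear_irrep (rho_char dmC).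
have [m [phi [phi0 phi_inj phi_cpl]]] := irrep_family_complete (linear_irrep chi).
have [f fP] := choice (fun i => formal_codegree_exists (phi i)).
have phi_lam i : (0 < i <= m)%N -> irrep_repr (phi i) lam = 0.
  case/andP=> i0 im; apply/irrep_regular; rewrite -/chi -phi0 => /phi_inj i00.
  by rewrite i00 // in i0.
have /choice[psi psiP] : forall i, exists psi : irrep K R, (0 < i <= m)%N ->
    exists h, psi = @zero_ext R S incl near_integral rho rhoP K (phi i) h.
  move=> i; have [im|im] := boolP (0 < i <= m)%N; last by exists psip.
  by exists (zero_ext (phi_lam i im)) => _; exists (phi_lam i im).
pose s := mkseq (fun i => f i.+1) m.
have size_s : size s = m by rewrite size_mkseq.
exists s.
  exists (fun i => phi i); split=> [i j iso|psi'|[[|i] /= im]].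
  - by apply/val_inj/phi_inj => //; rewrite -ltnS -size_s ltn_ord.
  - have [i im iso] := phi_cpl psi'.
    have im' : (i < size ((FPdim_ring K S)%:C :: s))%N by rewrite /= size_s ltnS.
    by exists (Ordinal im').
  - by rewrite phi0; apply: fpdim_char_codegree.
  - by rewrite ltnS size_s in im; rewrite nth_mkseq.
pose psiR i := match i with 0 => psip | 1 => psim | i.+2 => psi i.+1 end.
pose rho_val i : K := match i with 0 => dp | 1 => dm | _ => 0 end.
have psiR_rho i : (i < m.+2)%N ->
    irrep_repr (psiR i) (basis rho) = (rho_val i)%:C%:M.
  case: i => [|[|i]] im; rewrite /psiR.
  - by rewrite -[LHS]/((rho_char dpC (basis rho))%:M) rho_char_rho.
  - by rewrite -[LHS]/((rho_char dmC (basis rho))%:M) rho_char_rho.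
  - have [|h ->] := psiP i.+1; first by [].
    by rewrite [irrep_repr _ _](zero_ext_repr_rho h) /rho_val !raddf0.
have rho_val_eq i j : rho_val i = rho_val j -> i = j \/ (1 < i)%N && (1 < j)%N.
  have dpdm : dp != dm by rewrite gt_eqF // (lt_trans dm_lt0).
  case: i j => [|[|i]] [|[|j]] /= e; first [by left | by right | exfalso];
    by move: dp_gt0 dm_lt0 dpdm; rewrite e ?ltxx ?eqxx.
exists (fun i => psiR i); split=> [i j iso|psi'|i].
- have [im jm] : (i < m.+2)%N /\ (j < m.+2)%N by rewrite -size_s !ltn_ord.
  have /complexI/rho_val_eq[/val_inj//|] :=
    irrep_iso_scalar iso (psiR_rho _ im) (psiR_rho _ jm).
  case: i j iso im jm => [[|[|i]] lti] [[|[|j]] ltj] //= iso im jm _.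
  apply: val_inj.
  have [//|hi psii] := psiP i.+1; have [//|hj psij] := psiP j.+1.
  move: iso; rewrite /= psii psij => /zero_ext_iso/phi_inj ij.
  by congr _.+1; apply: ij.
- have size_sR : size [:: (FPdim_ring K S + dp ^+ 2)%:C,
      (FPdim_ring K S + dm ^+ 2)%:C & s] = m.+2 by rewrite /= size_s.
  suff [i im iso] : exists2 i, (i < m.+2)%N & irrep_iso psi' (psiR i).
    by rewrite -size_sR in im; exists (Ordinal im).
  have [[phi' [phi'0 iso]]|[t [tP psi'E]]] :=
    irrep_near_integral near_integral rhoP psi'.
    have [[|i] im phi'i] := phi_cpl phi'.
      by rewrite phi0 in phi'i; have /irrep_regular := phi'0.
    exists i.+2 => //; apply: irrep_iso_trans iso _ => /=.
    by have [//|h ->] := psiP i.+1; apply/zero_ext_iso.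
  have sumC : dp%:C + dm%:C = (fcoef rho rho rho)%:R :> K[i].
    have dpdm : dp%:C - dm%:C != 0 :> K[i].
      by rewrite -rmorphB fmorph_eq0 subr_eq0 gt_eqF // (lt_trans dm_lt0).
    apply: (mulfI dpdm); ring: dpC dmC.
  have : (t - dp%:C) * (t - dm%:C) == 0.
    have dmE : dm%:C = (fcoef rho rho rho)%:R - dp%:C :> K[i].
      by rewrite -sumC addrC addKr.
    by apply/eqP; ring: tP dpC dmE.
  rewrite mulf_eq0 !subr_eq0 => /orP[]/eqP tE.
  - exists 0%N => //; apply: (@scalar_irrep_iso _ _ _ _ (rho_char tP)) => // z.
    by rewrite /= /rho_char_fun tE.
  - exists 1%N => //; apply: (@scalar_irrep_iso _ _ _ _ (rho_char tP)) => // z.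
    by rewrite /= /rho_char_fun tE.
- case: i => [[|[|i]] /= im].
  + by rewrite rmorphD DE rmorph_int rmorphXn; apply: rho_char_codegree.
  + by rewrite rmorphD DE rmorph_int rmorphXn; apply: rho_char_codegree.
  + rewrite !ltnS size_s in im; rewrite nth_mkseq //.
    by have [//|h ->] := psiP i.+1; apply: zero_ext_codegree.
Qed.
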